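(* Let $s$ be a real number such that $s\geq 1$, and define the sets \[ \mathcal{L}_s=\left\{t\in [0,1/2] : \forall\,(a,b)\in \mathcal{D},\ Q_{t,s}(a,b)<I(a,b)\right\}, \] \[ \mathcal{U}_s=\left\{t\in [0,1/2] : \forall\,(a,b)\in \mathcal{D},\ I(a,b)<Q_{t,s}(a,b)\right\}. \] Then \[ \mathcal{L}_s=\left[0,\ \frac{1}{2}-\frac{1}{2}\sqrt{1-\left(\frac{2}{e}\right)^{2/s}}\right] \quad\text{and}\quad \mathcal{U}_s=\left[\frac{1}{2}-\frac{1}{2\sqrt{3s}},\ \frac{1}{2}\right]. \]
   Context: Let $\mathcal{D}=\{(a,b)\in\mathbb{R}^2 : a>b>0\}$. For positive real numbers $a,b$, the arithmetic mean is $A(a,b)=\frac{a+b}{2}$ and the geometric mean is $G(a,b)=\sqrt{ab}$. For distinct positive real numbers $a,b$, the identric mean is $I(a,b)=\frac{1}{e}\left(\frac{a^a}{b^b}\right)^{1/(a-b)}$. For real $s\geq 1$ and $t\in[0,1/2]$, the two-parameter mean $Q_{t,s}$ is defined by \[ Q_{t,s}(a,b)=G\big(ta+(1-t)b,\ tb+(1-t)a\big)^{s}\,A(a,b)^{1-s}. \] Here $e$ is the base of the natural logarithm. *)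

(* Defs.v *)
(* Stdlib's classical real numbers; sets of reals are Stdlib's [Ensemble R]. *)
From Stdlib Require Import Reals Ensembles.
Open Scope R_scope.

Definition calD (a b : R) : Prop := a > b /\ b > 0.

Definition A (a b : R) : R := (a + b) / 2.

Definition G (a b : R) : R := sqrt (a * b).

(* [Rpower x y] is the real power x^y only for x > 0; every base below is
   positive when a, b > 0 (and, in [Q], when moreover 0 <= t <= 1). *)
Definition I (a b : R) : R :=
  1 / exp 1 * Rpower (Rpower a a / Rpower b b) (1 / (a - b)).

Definition Q (t s a b : R) : R :=
  Rpower (G (t * a + (1 - t) * b) (t * b + (1 - t) * a)) s
  * Rpower (A a b) (1 - s).

Definition Icc (x y : R) : Ensemble R := fun t => x <= t <= y.

Definition calL (s : R) : Ensemble R := fun t =>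
  In R (Icc 0 (1 / 2)) t /\ forall a b : R, calD a b -> Q t s a b < I a b.

Definition calU (s : R) : Ensemble R := fun t =>
  In R (Icc 0 (1 / 2)) t /\ forall a b : R, calD a b -> I a b < Q t s a b.

(* Main.v *)
From Stdlib Require Import Lra FunctionalExtensionality PropExtensionality.
From Coquelicot Require Import Coquelicot.
Require Import Defs.
From Stdlib Require Import Reals Ensembles.
Open Scope R_scope.

(** Both means are homogeneous, so only [x = (a - b) / (a + b)], which ranges
    over [(0, 1)], matters. With [u = (1 - 2 t)^2] one finds
    [ln (Q / A) = s / 2 * ln (1 - u x^2)] and
    [ln (I / A) = ((1 + x) ln (1 + x) - (1 - x) ln (1 - x)) / (2 x) - 1], hence
    comparing [Q] with [I] amounts to finding the sign of
    [gap s u x = 2 x (ln Q - ln I)].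

    This function vanishes to second order at [0], and its second derivative
    is a positive factor times [P (x^2)], where [P] is the quadratic
    polynomial [curv s u], with [P 0 = 1 - 3 s u] and [P 1 = (1 - u)^2 >= 0].
    Since [s >= 1], [P] is concave; therefore either [P > 0] throughout
    [(0, 1)], or [P] changes sign at most once, from negative to positive.
    Two applications of the mean value theorem ([gap_double_mvt]) transport
    the sign of [P] to the gap.

    - If [3 s u > 1], then [P] and hence the gap are negative near [0], so
      [I < Q] everywhere forces [3 s u <= 1]; conversely [3 s u <= 1] gives [P > 0] on [(0, 1)] and
      therefore a positive gap ([gap_pos_iff]).
    - If the gap is nonnegative at some point, then so is [P] at an earlier one,
      which excludes [u = 1], where [P < 0]. For [u < 1], the sign pattern of
      [P] makes the gap increase strictly from the given point up to its limit
      at [1], which is [s ln (1 - u) + 2 - 2 ln 2]. So the gap is negative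
      throughout exactly when [u = 1] or this limit is at most [0]
      ([gap_neg_iff]).

    Solving the two conditions [3 s (1 - 2 t)^2 <= 1] and
    [1 - (2 / e)^(2 / s) <= (1 - 2 t)^2] for [t] gives the two intervals. *)

(** * The gap function and its derivatives *)

Definition gap (s u x : R) : R :=
  s * x * ln (1 - u * x ^ 2) + 2 * x
  - ((1 + x) * ln (1 + x) - (1 - x) * ln (1 - x)).

Definition gap' (s u x : R) : R :=
  s * ln (1 - u * x ^ 2) - 2 * s * u * x ^ 2 / (1 - u * x ^ 2)
  - ln (1 - x) - ln (1 + x).

(** The factor of the second derivative of the gap that decides its sign, in
    the variable [y = x^2]. *)
Definition curv (s u y : R) : R :=
  (1 - u * y) ^ 2 - s * u * (3 - u * y) * (1 - y).

Definition gap'' (s u x : R) : R :=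
  2 * x / ((1 - x ^ 2) * (1 - u * x ^ 2) ^ 2) * curv s u (x ^ 2).

Lemma one_minus_ux2_pos (u x : R) :
  0 <= u <= 1 -> 0 <= x < 1 -> 0 < 1 - u * x ^ 2.
Proof. intros Hu Hx. nra. Qed.

Lemma gap_derive (s u x : R) :
  0 <= u <= 1 -> 0 <= x < 1 -> derivable_pt_lim (gap s u) x (gap' s u x).
Proof.
  intros Hu Hx. pose proof (one_minus_ux2_pos u x Hu Hx) as Hp.
  apply is_derive_Reals. unfold gap, gap'. auto_derive.
  - simpl in Hp. repeat split; try lra.
  - simpl in Hp |- *. unfold Rminus. field. repeat split; lra.
Qed.

Lemma gap'_derive (s u x : R) :
  0 <= u <= 1 -> 0 <= x < 1 -> derivable_pt_lim (gap' s u) x (gap'' s u x).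
Proof.
  intros Hu Hx. pose proof (one_minus_ux2_pos u x Hu Hx) as Hp.
  assert (1 - x ^ 2 > 0) by nra.
  apply is_derive_Reals. unfold gap', gap'', curv. auto_derive.
  - simpl in Hp. repeat split; lra.
  - simpl in *. unfold Rminus. field. repeat split; lra.
Qed.

Lemma gap_0 (s u : R) : gap s u 0 = 0.
Proof.
  unfold gap. replace (1 - 0) with 1 by ring. replace (1 + 0) with 1 by ring.
  rewrite ln_1. ring.
Qed.

Lemma gap'_0 (s u : R) : gap' s u 0 = 0.
Proof.
  unfold gap'. replace (1 - u * 0 ^ 2) with 1 by ring.
  replace (1 - 0) with 1 by ring. replace (1 + 0) with 1 by ring.
  rewrite ln_1. field.
Qed.

(** Because the gap and its derivative vanish at [0], its value at [x] is a
    positive multiple of the derivative at an earlier point, which is itself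
    a positive multiple of [curv] at a still earlier one. *)
Lemma gap_double_mvt (s u x : R) :
  0 <= u <= 1 -> 0 < x < 1 ->
  exists c c1 k, 0 < c < c1 /\ c1 < x /\ 0 < k /\
    gap s u x = x * gap' s u c1 /\ gap' s u c1 = k * curv s u (c ^ 2).
Proof.
  intros Hu Hx.
  destruct (MVT_cor2 (gap s u) (gap' s u) 0 x) as [c1 [E1 H1]]; [lra| |].
  { intros c Hc. apply gap_derive; lra. }
  destruct (MVT_cor2 (gap' s u) (gap'' s u) 0 c1) as [c [E H]]; [lra| |].
  { intros c Hc. apply gap'_derive; lra. }
  rewrite gap_0 in E1. rewrite gap'_0 in E. unfold gap'' in E.
  assert (Hp := one_minus_ux2_pos u c Hu ltac:(lra)).
  assert (0 < 1 - c ^ 2) by nra.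
  exists c, c1, (c1 * (2 * c / ((1 - c ^ 2) * (1 - u * c ^ 2) ^ 2))).
  repeat split; try lra.
  apply Rmult_lt_0_compat; [lra|]. apply Rdiv_lt_0_compat; [lra|].
  apply Rmult_lt_0_compat; [lra|]. apply pow_lt; lra.
Qed.

(** * Positivity of the gap *)

(** The worst case is [s u = 1 / 3]. The lower bound then factors as [y] times
    a quantity bounded below, because [u <= s u <= 1 / 3]. *)
Lemma curv_pos (s u y : R) :
  1 <= s -> 0 <= u -> 3 * s * u <= 1 -> 0 < y < 1 -> 0 < curv s u y.
Proof.
  intros Hs Hu Hsu Hy. unfold curv.
  assert (Hu3 : u <= 1 / 3) by nra.
  assert (Hf : 0 <= (3 - u * y) * (1 - y)) by (apply Rmult_le_pos; nra).
  assert (s * u * ((3 - u * y) * (1 - y)) <= 1 / 3 * ((3 - u * y) * (1 - y)))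
    by (apply Rmult_le_compat_r; lra).
  assert (E : (1 - u * y) ^ 2 - 1 / 3 * ((3 - u * y) * (1 - y))
    = y * (1 - 5 / 3 * u + u * u * y - u * y / 3)) by field.
  assert (0 < y * (1 - 5 / 3 * u + u * u * y - u * y / 3))
    by (apply Rmult_lt_0_compat; nra).
  lra.
Qed.

Lemma gap_pos_iff (s u : R) :
  1 <= s -> 0 <= u <= 1 ->
  (forall x, 0 < x < 1 -> 0 < gap s u x) <-> 3 * s * u <= 1.
Proof.
  intros Hs Hu. split.
  - intros H. destruct (Rle_or_lt (3 * s * u) 1) as [|Hsu]; [assumption|exfalso].
    (* On [(0, 1)], [curv s u y <= 1 - 3 s u + 4 s y], which is negative for
       [y] up to the following [x]. *)
    set (x := Rmin (1 / 2) ((3 * s * u - 1) / (8 * s))).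
    assert (Hx0 : 0 < (3 * s * u - 1) / (8 * s)) by (apply Rdiv_lt_0_compat; lra).
    assert (Hx : 0 < x) by (apply Rmin_pos; lra).
    assert (Hx1 : x <= 1 / 2) by apply Rmin_l.
    assert (Hx2 : x <= (3 * s * u - 1) / (8 * s)) by apply Rmin_r.
    apply (Rmult_le_compat_r (8 * s)) in Hx2; [|lra].
    replace ((3 * s * u - 1) / (8 * s) * (8 * s)) with (3 * s * u - 1) in Hx2
      by (field; lra).
    destruct (gap_double_mvt s u x Hu ltac:(lra))
      as (c & c1 & k & Hc & Hc1 & Hk & E1 & E).
    specialize (H x ltac:(lra)).
    assert (Hy : 0 <= c ^ 2 <= x) by nra.
    assert (Hneg : curv s u (c ^ 2) < 0).
    { unfold curv. set (y := c ^ 2) in *.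
      assert (y * (u ^ 2 * y) <= y * u).
      { apply Rmult_le_compat_l; [lra|]. nra. }
      assert (0 <= s * u * y * (u * y)) by (repeat apply Rmult_le_pos; lra).
      assert (s * y * (u * (3 + u)) <= s * y * 4)
        by (apply Rmult_le_compat_l; nra).
      assert (s * y <= s * x) by (apply Rmult_le_compat_l; lra).
      nra. }
    assert (gap' s u c1 < 0) by (rewrite E; nra).
    nra.
  - intros Hsu x Hx.
    destruct (gap_double_mvt s u x Hu Hx)
      as (c & c1 & k & Hc & Hc1 & Hk & E1 & E).
    assert (0 < curv s u (c ^ 2)) by (apply curv_pos; nra).
    rewrite E1, E. repeat apply Rmult_lt_0_compat; lra.
Qed.

(** * Negativity of the gap *)

(** Concavity of [curv], which is where [1 <= s] enters, together with
    [curv s u 1 = (1 - u)^2 > 0]. *)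
Lemma curv_pos_after (s u y0 y : R) :
  1 <= s -> u < 1 -> y0 < y < 1 -> 0 <= curv s u y0 -> 0 < curv s u y.
Proof.
  intros Hs Hu Hy H0.
  assert (E : curv s u y * (1 - y0)
    = (1 - y) * curv s u y0 + (y - y0) * (1 - u) ^ 2
      + (s - 1) * u ^ 2 * ((y - y0) * (1 - y) * (1 - y0)))
    by (unfold curv; ring).
  assert (0 <= (1 - y) * curv s u y0) by (apply Rmult_le_pos; lra).
  assert (0 < (y - y0) * (1 - u) ^ 2)
    by (apply Rmult_lt_0_compat; [lra | apply pow_lt; lra]).
  assert (0 <= (s - 1) * u ^ 2 * ((y - y0) * (1 - y) * (1 - y0))).
  { apply Rmult_le_pos.
    - apply Rmult_le_pos; [lra | apply pow2_ge_0].
    - repeat apply Rmult_le_pos; lra. }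
  apply (Rmult_lt_reg_r (1 - y0)); lra.
Qed.

(** For [u = 1] the polynomial has the factor [1 - y], and the cofactor
    [1 - 3 s + (s - 1) y] is negative. *)
Lemma curv_1_neg (s y : R) : 1 <= s -> 0 <= y < 1 -> curv s 1 y < 0.
Proof.
  intros Hs Hy.
  replace (curv s 1 y) with (- ((1 - y) * (3 * s - 1 - (s - 1) * y)))
    by (unfold curv; ring).
  assert (0 < (1 - y) * (3 * s - 1 - (s - 1) * y))
    by (apply Rmult_lt_0_compat; nra).
  lra.
Qed.

(** The gap without its term [(1 - x) ln (1 - x)], which tends to [0] at [1].
    What remains extends smoothly beyond [1] when [u < 1], so its value at [1]
    is the limit of the gap there. *)
Definition regular_gap (s u x : R) : R :=
  s * x * ln (1 - u * x ^ 2) + 2 * x - (1 + x) * ln (1 + x).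

(** Shows that [z ln z] tends to [0] at [0]. It is [ln w <= w - 1] at
    [w = 1 / sqrt z]. *)
Lemma xlnx_lower_bound (z : R) : 0 < z -> - sqrt z <= z * ln z / 2.
Proof.
  intros Hz. assert (Hr := sqrt_lt_R0 z Hz).
  rewrite <- (sqrt_sqrt z) at 2 3 by lra.
  set (r := sqrt z) in *. rewrite ln_mult by lra.
  (* [1 + w <= exp w] at [w = - ln r] *)
  assert (H := exp_ineq1_le (- ln r)). rewrite exp_Ropp, exp_ln in H by lra.
  assert (r * r * (1 - / r) <= r * r * ln r) by (apply Rmult_le_compat_l; nra).
  assert (r * r * (1 - / r) = r * r - r) by (field; lra).
  nra.
Qed.

Lemma continuous_ge0_at_right_end (f : R -> R) (x0 x1 : R) :
  continuous f x1 -> x0 < x1 -> (forall x, x0 < x < x1 -> 0 <= f x) ->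
  0 <= f x1.
Proof.
  intros Hf Hx H. apply Rnot_lt_le. intros Hneg.
  assert (HU : locally (f x1) (fun y => y < 0)) by (apply (open_lt 0); exact Hneg).
  destruct (Hf _ HU) as [d Hd].
  set (h := Rmin (d / 2) ((x1 - x0) / 2)).
  assert (Hd0 := cond_pos d).
  assert (0 < h) by (apply Rmin_pos; lra).
  assert (h <= d / 2) by apply Rmin_l.
  assert (h <= (x1 - x0) / 2) by apply Rmin_r.
  assert (f (x1 - h) < 0).
  { apply Hd. change (Rabs (x1 - h - x1) < d).
    rewrite Rabs_left by lra. lra. }
  specialize (H (x1 - h) ltac:(lra)). lra.
Qed.

Lemma regular_gap_continuous_1 (s u : R) :
  u < 1 -> continuous (regular_gap s u) 1.
Proof.
  intros Hu. apply (ex_derive_continuous (V := R_NormedModule)).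
  unfold regular_gap. auto_derive. repeat split; lra.
Qed.

Lemma regular_gap_1 (s u : R) :
  regular_gap s u 1 = s * ln (1 - u) + 2 - 2 * ln 2.
Proof.
  unfold regular_gap. replace (1 - u * 1 ^ 2) with (1 - u) by ring.
  replace (1 + 1) with 2 by ring. ring.
Qed.

Lemma gap_le_regular_gap (s u x : R) :
  0 < x < 1 -> gap s u x <= regular_gap s u x.
Proof.
  intros Hx. unfold gap, regular_gap.
  assert (ln (1 - x) < 0) by (rewrite <- ln_1; apply ln_increasing; lra).
  nra.
Qed.

(** By [curv_pos_after] the second derivative is positive from [c] on, so the
    derivative, nonnegative at [c1], is positive beyond [c1]. *)
Lemma gap_increasing_after (s u c c1 x y : R) :
  1 <= s -> 0 <= u < 1 -> 0 < c < c1 ->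
  0 <= curv s u (c ^ 2) -> 0 <= gap' s u c1 ->
  c1 <= x < y -> y < 1 -> gap s u x < gap s u y.
Proof.
  intros Hs Hu Hc HP Hg Hx Hy.
  destruct (MVT_cor2 (gap s u) (gap' s u) x y) as [z [Ez Hz]]; [lra| |].
  { intros d Hd. apply gap_derive; lra. }
  destruct (MVT_cor2 (gap' s u) (gap'' s u) c1 z) as [w [Ew Hw]]; [lra| |].
  { intros d Hd. apply gap'_derive; lra. }
  assert (0 < gap'' s u w).
  { unfold gap''. assert (Hp := one_minus_ux2_pos u w ltac:(lra) ltac:(lra)).
    assert (0 < 1 - w ^ 2) by nra.
    apply Rmult_lt_0_compat.
    - apply Rdiv_lt_0_compat; [lra|].
      apply Rmult_lt_0_compat; [lra | apply pow_lt; lra].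
    - apply (curv_pos_after s u (c ^ 2)); nra. }
  assert (0 < gap'' s u w * (z - c1)) by (apply Rmult_lt_0_compat; lra).
  assert (0 < gap' s u z * (y - x)) by (apply Rmult_lt_0_compat; lra).
  lra.
Qed.

(** The right-hand condition says that the limit of the gap at [1] is at most
    [0]; for [u = 1] this limit is minus infinity. A nonnegative value inside
    would be followed by strict increase up to the limit, which would then be
    positive. *)
Lemma gap_neg_iff (s u : R) :
  1 <= s -> 0 <= u <= 1 ->
  (forall x, 0 < x < 1 -> gap s u x < 0) <->
  (u < 1 -> s * ln (1 - u) + 2 - 2 * ln 2 <= 0).
Proof.
  intros Hs Hu. split.
  - intros H Hu1. rewrite <- regular_gap_1.
    (* [f] is nonnegative on [(0, 1)] because [- 2 sqrt (1 - x)] bounds the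
       omitted term from below, and it does not change the value at [1]. *)
    set (f := fun x => 2 * sqrt (1 - x) - regular_gap s u x).
    assert (H1 : 0 <= f 1).
    { apply (continuous_ge0_at_right_end f 0 1); [|lra|].
      - apply (continuous_minus (V := R_NormedModule)
          (fun x => 2 * sqrt (1 - x)) (regular_gap s u)).
        + apply (continuous_scal_r (V := R_NormedModule) 2 (fun x => sqrt (1 - x))).
          apply (continuous_comp (fun x => 1 - x) sqrt).
          * apply (ex_derive_continuous (V := R_NormedModule)).
            auto_derive. exact Logic.I.
          * apply continuous_sqrt.
        + apply regular_gap_continuous_1; assumption.
      - intros x Hx. specialize (H x Hx).
        assert (Hl := xlnx_lower_bound (1 - x) ltac:(lra)).
        unfold f. unfold gap in H. unfold regular_gap. lra. }
    unfold f in H1. replace (1 - 1) with 0 in H1 by ring.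
    rewrite sqrt_0 in H1. lra.
  - intros Hend x Hx. apply Rnot_le_lt. intros Hge.
    destruct (gap_double_mvt s u x Hu Hx)
      as (c & c1 & k & Hc & Hc1 & Hk & E1 & E).
    assert (Hg : 0 <= gap' s u c1)
      by (apply (Rmult_le_reg_l x); lra).
    assert (HP : 0 <= curv s u (c ^ 2))
      by (apply (Rmult_le_reg_l k); lra).
    assert (Hu1 : u < 1).
    { destruct (proj2 Hu) as [Hu1|Hu1]; [assumption|exfalso].
      rewrite Hu1 in HP.
      assert (curv s 1 (c ^ 2) < 0) by (apply curv_1_neg; nra). lra. }
    specialize (Hend Hu1). rewrite <- regular_gap_1 in Hend.
    set (x1 := (x + 1) / 2).
    assert (Hincr : forall y z, c1 <= y < z -> z < 1 -> gap s u y < gap s u z).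
    { intros y z. apply (gap_increasing_after s u c c1 y z); lra. }
    assert (gap s u x < gap s u x1) by (apply Hincr; unfold x1; lra).
    assert (H1 : 0 <= regular_gap s u 1 - gap s u x1).
    { apply (continuous_ge0_at_right_end
        (fun y => regular_gap s u y - gap s u x1) x1 1); [|unfold x1; lra|].
      - apply (continuous_minus (V := R_NormedModule)
          (regular_gap s u) (fun _ => gap s u x1)).
        + apply regular_gap_continuous_1; assumption.
        + apply continuous_const.
      - intros y Hy. assert (gap s u x1 < gap s u y) by (apply Hincr; unfold x1 in *; lra).
        assert (gap s u y <= regular_gap s u y)
          by (apply gap_le_regular_gap; unfold x1 in *; lra).
        lra. }
    lra.
Qed.

(** * From the means to the gap *)

Lemma ln_sqrt_half (p : R) : 0 < p -> ln (sqrt p) = ln p / 2.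
Proof.
  intros Hp. assert (0 < sqrt p) by (apply sqrt_lt_R0; lra).
  rewrite <- (sqrt_sqrt p) at 2 by lra. rewrite ln_mult by lra. lra.
Qed.

Lemma I_normalized (m x : R) :
  0 < m -> 0 < x < 1 ->
  I (m * (1 + x)) (m * (1 - x))
  = exp (ln m - 1 + ((1 + x) * ln (1 + x) - (1 - x) * ln (1 - x)) / (2 * x)).
Proof.
  intros Hm Hx. unfold I, Rpower.
  rewrite ln_div by apply exp_pos. rewrite !ln_exp, !ln_mult by lra.
  unfold Rdiv at 1. rewrite Rmult_1_l, <- exp_Ropp, <- exp_plus.
  f_equal. field. split; nra.
Qed.

Lemma Q_normalized (t s m x : R) :
  0 <= t <= 1 / 2 -> 0 < m -> 0 < x < 1 ->
  Q t s (m * (1 + x)) (m * (1 - x))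
  = exp (ln m + s / 2 * ln (1 - (1 - 2 * t) ^ 2 * x ^ 2)).
Proof.
  intros Ht Hm Hx. unfold Q, G, A, Rpower.
  assert (Hp : 0 < 1 - (1 - 2 * t) ^ 2 * x ^ 2)
    by (apply one_minus_ux2_pos; nra).
  replace ((t * (m * (1 + x)) + (1 - t) * (m * (1 - x)))
           * (t * (m * (1 - x)) + (1 - t) * (m * (1 + x))))
    with (m * m * (1 - (1 - 2 * t) ^ 2 * x ^ 2)) by ring.
  replace ((m * (1 + x) + m * (1 - x)) / 2) with m by field.
  assert (0 < m * m) by nra.
  rewrite ln_sqrt_half by (apply Rmult_lt_0_compat; lra).
  rewrite !ln_mult by lra. rewrite <- exp_plus. f_equal. field.
Qed.

(** Writing both means as exponentials turns each strict inequality between them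
    into a sign of the gap; here [k = 1 / (2 x)]. *)
Lemma Q_I_gap (t s m x : R) :
  0 <= t <= 1 / 2 -> 0 < m -> 0 < x < 1 ->
  exists k l, 0 < k /\ I (m * (1 + x)) (m * (1 - x)) = exp l /\
    Q t s (m * (1 + x)) (m * (1 - x)) = exp (l + k * gap s ((1 - 2 * t) ^ 2) x).
Proof.
  intros Ht Hm Hx. eexists (/ (2 * x)), _. split; [|split].
  - apply Rinv_0_lt_compat. lra.
  - apply I_normalized; assumption.
  - rewrite Q_normalized by assumption. f_equal. unfold gap. field. lra.
Qed.

(** Here [m] is the arithmetic mean. *)
Lemma calD_normalized (a b : R) :
  calD a b -> exists m x, 0 < m /\ 0 < x < 1 /\ a = m * (1 + x) /\ b = m * (1 - x).
Proof.
  intros [Hab Hb]. exists ((a + b) / 2), ((a - b) / (a + b)).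
  repeat split; try (field; lra); try lra.
  - apply Rdiv_lt_0_compat; lra.
  - apply (Rmult_lt_reg_r (a + b)); [lra|].
    replace ((a - b) / (a + b) * (a + b)) with (a - b) by (field; lra). lra.
Qed.

Lemma calD_of_normalized (x : R) : 0 < x < 1 -> calD (1 * (1 + x)) (1 * (1 - x)).
Proof. intros Hx. split; lra. Qed.

Lemma Q_lt_I_iff_gap (t s : R) :
  0 <= t <= 1 / 2 ->
  (forall a b, calD a b -> Q t s a b < I a b) <->
  (forall x, 0 < x < 1 -> gap s ((1 - 2 * t) ^ 2) x < 0).
Proof.
  intros Ht. split.
  - intros H x Hx. specialize (H _ _ (calD_of_normalized x Hx)).
    destruct (Q_I_gap t s 1 x Ht Rlt_0_1 Hx) as (k & l & Hk & EI & EQ).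
    rewrite EI, EQ in H. apply exp_lt_inv in H. nra.
  - intros H a b Hab.
    destruct (calD_normalized a b Hab) as (m & x & Hm & Hx & -> & ->).
    destruct (Q_I_gap t s m x Ht Hm Hx) as (k & l & Hk & EI & EQ).
    rewrite EI, EQ. apply exp_increasing. specialize (H x Hx). nra.
Qed.

Lemma I_lt_Q_iff_gap (t s : R) :
  0 <= t <= 1 / 2 ->
  (forall a b, calD a b -> I a b < Q t s a b) <->
  (forall x, 0 < x < 1 -> 0 < gap s ((1 - 2 * t) ^ 2) x).
Proof.
  intros Ht. split.
  - intros H x Hx. specialize (H _ _ (calD_of_normalized x Hx)).
    destruct (Q_I_gap t s 1 x Ht Rlt_0_1 Hx) as (k & l & Hk & EI & EQ).
    rewrite EI, EQ in H. apply exp_lt_inv in H. nra.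
  - intros H a b Hab.
    destruct (calD_normalized a b Hab) as (m & x & Hm & Hx & -> & ->).
    destruct (Q_I_gap t s m x Ht Hm Hx) as (k & l & Hk & EI & EQ).
    rewrite EI, EQ. apply exp_increasing. specialize (H x Hx). nra.
Qed.

(** * The thresholds *)

Lemma end_condition_iff (s v : R) :
  1 <= s -> 0 < v ->
  s * ln v + 2 - 2 * ln 2 <= 0 <-> v <= Rpower (2 / exp 1) (2 / s).
Proof.
  intros Hs Hv.
  set (e := 2 / s * (ln 2 - 1)).
  assert (Ek : Rpower (2 / exp 1) (2 / s) = exp e).
  { unfold Rpower. rewrite ln_div by (try apply exp_pos; lra).
    rewrite ln_exp. reflexivity. }
  assert (Ee : s * e = 2 * ln 2 - 2) by (unfold e; field; lra).
  rewrite Ek. split; intros H.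
  - rewrite <- (exp_ln v) by assumption. apply Rnot_lt_le.
    intros Hlt. apply exp_lt_inv, (Rmult_lt_compat_l s) in Hlt; lra.
  - apply ln_le in H; [|assumption]. rewrite ln_exp in H.
    apply (Rmult_le_compat_l s) in H; lra.
Qed.

(** For [z < 0] both sides hold, since [sqrt z] is then [0]. *)
Lemma sqrt_le_iff (z r : R) : 0 <= r -> sqrt z <= r <-> z <= r ^ 2.
Proof.
  intros Hr. split; intros H.
  - destruct (Rle_or_lt z 0) as [Hz|Hz]; [nra|].
    rewrite <- (sqrt_sqrt z) by lra. assert (0 <= sqrt z) by apply sqrt_pos. nra.
  - rewrite <- (sqrt_pow2 r) by assumption. apply sqrt_le_1_alt. assumption.
Qed.

Lemma lower_threshold_iff (s t : R) :
  1 <= s -> 0 <= t <= 1 / 2 ->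
  ((1 - 2 * t) ^ 2 < 1 -> s * ln (1 - (1 - 2 * t) ^ 2) + 2 - 2 * ln 2 <= 0) <->
  t <= 1 / 2 - 1 / 2 * sqrt (1 - Rpower (2 / exp 1) (2 / s)).
Proof.
  intros Hs Ht.
  set (k := Rpower (2 / exp 1) (2 / s)).
  assert (Hk : 0 < k) by apply exp_pos.
  assert (Hsq := sqrt_le_iff (1 - k) (1 - 2 * t) ltac:(lra)).
  split; intros H.
  - assert (sqrt (1 - k) <= 1 - 2 * t); [|lra].
    apply Hsq. destruct (Rlt_or_le ((1 - 2 * t) ^ 2) 1) as [Hu|Hu]; [|lra].
    specialize (H Hu). apply end_condition_iff in H; fold k in H; lra.
  - intros Hu. apply end_condition_iff; fold k; lra.
Qed.

Lemma upper_threshold_iff (s t : R) :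
  0 < s -> t <= 1 / 2 ->
  3 * s * (1 - 2 * t) ^ 2 <= 1 <-> 1 / 2 - 1 / (2 * sqrt (3 * s)) <= t.
Proof.
  intros Hs Ht.
  set (r := sqrt (3 * s)).
  assert (Hr : 0 < r) by (apply sqrt_lt_R0; lra).
  replace (3 * s) with (r * r) by (apply sqrt_sqrt; lra).
  assert (E : r * (1 / (2 * r)) = 1 / 2) by (field; lra).
  assert (Hrt : 0 <= r * (1 - 2 * t)) by (apply Rmult_le_pos; lra).
  split; intros H.
  - apply (Rmult_le_reg_l r); [lra|]. nra.
  - apply (Rmult_le_compat_l r) in H; [|lra]. nra.
Qed.

Lemma upper_threshold_ge0 (s : R) :
  1 <= s -> 0 <= 1 / 2 - 1 / (2 * sqrt (3 * s)).
Proof.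
  intros Hs.
  assert (Hr : 1 <= sqrt (3 * s)) by (rewrite <- sqrt_1 at 1; apply sqrt_le_1_alt; lra).
  assert (1 / (2 * sqrt (3 * s)) <= 1 / 2); [|lra].
  unfold Rdiv. apply Rmult_le_compat_l; [lra|]. apply Rinv_le_contravar; lra.
Qed.

Lemma Ensemble_ext (X Y : Ensemble R) : (forall t, X t <-> Y t) -> X = Y.
Proof.
  intros H. apply functional_extensionality. intros t.
  apply propositional_extensionality. apply H.
Qed.

Theorem theorem3p1 (s : R) (hs : s >= 1) :
  calL s = Icc 0 (1 / 2 - 1 / 2 * sqrt (1 - Rpower (2 / exp 1) (2 / s))) /\
  calU s = Icc (1 / 2 - 1 / (2 * sqrt (3 * s))) (1 / 2).
Proof.
  apply Rge_le in hs.
  assert (Hu : forall t, 0 <= t <= 1 / 2 -> 0 <= (1 - 2 * t) ^ 2 <= 1)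
    by (intros t Ht; nra).
  split; apply Ensemble_ext; intros t.
  - assert (H := sqrt_pos (1 - Rpower (2 / exp 1) (2 / s))).
    unfold calL, In, Icc. split.
    + intros [Ht HQ]. split; [lra|].
      apply lower_threshold_iff; [lra..|].
      apply gap_neg_iff; auto. apply Q_lt_I_iff_gap; auto.
    + intros Ht. assert (Ht' : 0 <= t <= 1 / 2) by lra. split; [assumption|].
      apply Q_lt_I_iff_gap; [assumption|]. apply gap_neg_iff; auto.
      apply lower_threshold_iff; lra.
  - assert (H := upper_threshold_ge0 s hs).
    unfold calU, In, Icc. split.
    + intros [Ht HQ]. split; [|lra].
      apply upper_threshold_iff; [lra..|].
      apply gap_pos_iff; auto. apply I_lt_Q_iff_gap; auto.
    + intros Ht. assert (Ht' : 0 <= t <= 1 / 2) by lra. split; [assumption|].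
      apply I_lt_Q_iff_gap; [assumption|]. apply gap_pos_iff; auto.
      apply upper_threshold_iff; lra.
Qed.
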